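(* Let $S$ be a subsemigroup of $T(X)$ with $Sur(X)\subset S$. Then $S$ is a maximal subsemigroup of $T(X)$ if and only if $S=T(X)\setminus Inj(X)$ or $S=T(X)\setminus FI(X)$.
   Context: $X$ is a countably infinite set (one may take $X=\mathbb{N}$) and $T(X)$ is the monoid of all full transformations (maps $X\to X$) under composition. A subsemigroup $S$ of $T(X)$ is maximal if $S\neq T(X)$ and there is no subsemigroup of $T(X)$ lying strictly between $S$ and $T(X)$. For $\alpha\in T(X)$: $im\,\alpha$ is its range, $rank(\alpha)=|im\,\alpha|$, the defect is $d(\alpha)=|X\setminus im\,\alpha|$, and the collapse is $c(\alpha)=\sum_{y\in im\,\alpha}(|y\alpha^{-1}|-1)$, where $y\alpha^{-1}$ is the preimage of $y$. $Inj(X)=\{\alpha\in T(X)\mid rank(\alpha)=\aleph_0,\ c(\alpha)=0,\ d(\alpha)\neq 0\}$ (injective but not surjective maps); $Sur(X)=\{\alpha\in T(X)\mid rank(\alpha)=\aleph_0,\ c(\alpha)\neq 0,\ d(\alpha)=0\}$ (surjective but not injective maps); $FI(X)=\{\alpha\in T(X)\mid rank(\alpha)=\aleph_0,\ d(\alpha)=\aleph_0,\ c(\alpha)<\aleph_0\}$. *)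

(* Defs.v *)
From mathcomp Require Import all_boot all_order all_algebra.
From mathcomp Require Import all_classical all_reals all_analysis.

Set Implicit Arguments.
Unset Strict Implicit.
Unset Printing Implicit Defensive.

Import Order.TTheory GRing.Theory Num.Theory.

Local Open Scope classical_set_scope.
Local Open Scope ring_scope.
Local Open Scope ereal_scope.

(* A countable set has cardinality 0, 1, 2, ... or aleph_0, so the cardinals   *)
(* below take values in \bar R through [counting], with +oo standing for       *)
(* aleph_0; the choice of R is immaterial.                                     *)
Section transformations.
Context (R : realType) (X : choiceType).
Implicit Types (a : X -> X) (S : set (X -> X)).

Definition rank a : \bar R := counting (range a).

Definition defect a : \bar R := counting (~` range a).

Definition collapse a : \bar R :=
  \esum_(y in range a) (counting (a @^-1` [set y]) - 1).

Definition InjX : set (X -> X) :=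
  [set a | [/\ rank a = +oo, collapse a = 0 & defect a <> 0]].

Definition SurX : set (X -> X) :=
  [set a | [/\ rank a = +oo, collapse a <> 0 & defect a = 0]].

Definition FIX : set (X -> X) :=
  [set a | [/\ rank a = +oo, defect a = +oo & collapse a < +oo]].

Definition subsemigroup S : Prop :=
  S !=set0 /\ forall a b, S a -> S b -> S (b \o a).

Definition maximal_subsemigroup S : Prop :=
  [/\ subsemigroup S, S <> [set: X -> X] &
      ~ exists U : set (X -> X),
          [/\ subsemigroup U, S `<` U & U `<` [set: X -> X]]].

End transformations.

Arguments InjX R X : clear implicits.
Arguments SurX R X : clear implicits.
Arguments FIX R X : clear implicits.

(* Main.v *)
(* [Inj] and [FI] have subsemigroups as complements, and any single element of
   either set generates T(X) together with its complement, so both complements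
   are maximal. Conversely, suppose that S contains [Sur], some f in [Inj] and
   some g in [FI]. Every permutation is s \o f for some s in [Sur], so S
   contains all permutations. Alternating f with transpositions gives
   injections in S whose range avoids the finite set off which g is injective;
   following one of them by g gives an injection i in S of infinite defect.
   Every map a is then s \o i for some s in [Sur], where s sends the complement
   of the range of i onto X; hence S = T(X). So a maximal S containing [Sur]
   misses [Inj] or misses [FI]. *)

Require Import Defs.
From mathcomp Require Import all_boot all_order all_algebra.
From mathcomp Require Import finmap.
From mathcomp Require Import all_classical all_reals all_analysis.

Import Order.TTheory GRing.Theory Num.Theory.

Local Open Scope classical_set_scope.
Local Open Scope card_scope.

(** * Cardinalities of sets as extended reals *)

Lemma le_counting (R : realType) (X : choiceType) (A B : set X) :
  A `<=` B -> (counting A <= counting B :> \bar R)%E.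
Proof.
move=> AB; rewrite /counting; case: ifPn => /asboolP fA;
  case: ifPn => /asboolP fB.
- by rewrite lee_fin ler_nat; apply: fsubset_leq_card; rewrite -fset_set_sub.
- exact: leey.
- by case: fA; exact: sub_finite_set fB.
- exact: lexx.
Qed.

Lemma counting_eqy (R : realType) (X : choiceType) (A : set X) :
  counting A = +oo%E :> \bar R <-> infinite_set A.
Proof. by rewrite /counting; case: ifPn => /asboolP. Qed.

Lemma counting_set1 (R : realType) (X : choiceType) (x : X) :
  counting [set x] = 1%E :> \bar R.
Proof. by rewrite /counting asboolT// fset_set1 cardfs1. Qed.

Lemma counting_set2 (R : realType) (X : choiceType) (x y : X) :
  x <> y -> counting [set x; y] = 2%:E%E :> \bar R.
Proof.
move=> /eqP xy; rewrite /counting asboolT// fset_setU// !fset_set1.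
by rewrite cardfs2 xy.
Qed.

Lemma counting_eq0 (R : realType) (X : choiceType) (A : set X) :
  counting A = 0%E :> \bar R <-> A = set0.
Proof.
split=> [A0|->]; last by rewrite /counting asboolT// fset_set0.
apply/eqP; apply: contraT => /set0P[x Ax].
have : (counting [set x] <= counting A :> \bar R)%E.
  by apply: le_counting => _ ->.
by rewrite A0 counting_set1 lee_fin ler10.
Qed.

(** * Collapse expressed through injectivity *)

Section collapse.
Context (R : realType) (X : choiceType).
Implicit Types a : X -> X.

Let fiber a (y : X) : set X := a @^-1` [set y].

Lemma collapse_term_ge0 a y : range a y ->
  (0 <= counting (fiber a y) - 1 :> \bar R)%E.
Proof.
case=> x _ <-; rewrite sube_ge0 ?fin_numE// -(@counting_set1 R X x).
by apply: le_counting => _ ->.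
Qed.

Lemma collapse_term_ge1 a x x' : a x = a x' -> x <> x' ->
  (1 <= counting (fiber a (a x)) - 1 :> \bar R)%E.
Proof.
move=> axx' xx'; rewrite leeBrDr// -EFinD.
rewrite -[(1 + 1)%R]/(2%R) -(@counting_set2 R X x x')//.
by apply: le_counting => z [->|->].
Qed.

Lemma collapse_term_inj a y : range a y ->
  (forall x x', a x = y -> a x' = y -> x = x') ->
  (counting (fiber a y) - 1 = 0 :> \bar R)%E.
Proof.
case=> x _ <- inja; rewrite (_ : fiber a (a x) = [set x]).
  by rewrite counting_set1 subee.
by apply/seteqP; split=> [z az|_ ->//]; exact: inja.
Qed.

Lemma collapse_eq0 a : collapse R a = 0%E <-> injective a.
Proof.
split=> [a0 x x' axx'|inja]; last first.
  by apply: esum1 => y ay; apply: collapse_term_inj => // x x' <- /esym/inja.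
apply: contrapT => xx'.
have : (1 <= collapse R a)%E.
  apply: (le_trans (collapse_term_ge1 _ _ _ axx' xx')).
  apply: esum_ge; exists [set a x]; last by rewrite fsbig_set1.
  by split=> // _ ->; exists x.
by rewrite a0 lee_fin ler10.
Qed.

Lemma collapse_lty a : (collapse R a < +oo)%E <->
  exists2 F, finite_set F & set_inj (~` F) a.
Proof.
split=> [alty|[F finF injF]].
  pose G := [set y | exists x x', [/\ a x = y, a x' = y & x <> x']].
  have Ga : G `<=` range a by move=> y [x [_ [ax _ _]]]; exists x.
  have finG : finite_set G.
    apply: contrapT => infG.
    have a0 : (0 <= collapse R a)%E.
      by apply: esum_ge0; exact: collapse_term_ge0.
    have afin : collapse R a \is a fin_num by rewrite ge0_fin_numE.
    (* A finite part of [G] with more points than the value of [collapse R a]: its terms, each at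
       least 1, already exceed the sum. *)
    have [A AG leA] :=
      infinite_set_fset (Num.truncn (fine (collapse R a))).+1 infG.
    have : ((#|` A|)%:R%:E <= collapse R a)%E.
      apply: esum_ge; exists [set` A].
        by split; [exact: finite_fset|move=> y /AG/Ga].
      rewrite fsbig_finite//= set_fsetK -sum1_size.
      rewrite natr_sum -sumEFin big_seq [leRHS]big_seq.
      apply: lee_sum => y /AG[x [x' [<- axx' xx']]].
      by apply: (collapse_term_ge1 _ x x').
    rewrite -(fineK afin) lee_fin leNgt => /negP; apply.
    rewrite (lt_le_trans (truncnS_gt _))// ler_nat.
    exact: leA.
  have finf y : G y -> finite_set (fiber a y).
    move=> /Ga ay; apply: contrapT => /(counting_eqy R) fy.
    have : (counting (fiber a y) - 1 <= collapse R a)%E.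
      apply: esum_ge; exists [set y]; last by rewrite fsbig_set1.
      by split=> // _ ->.
    by rewrite fy leNgt alty.
  exists (\bigcup_(y in G) fiber a y); first exact: bigcup_finite.
  move=> x x' /set_mem xF _ axx'; apply: contrapT => xx'.
  by apply: xF; exists (a x) => //; exists x, x'.
(* A fibre has at most one point outside [F]. *)
have finf y : finite_set (fiber a y).
  apply: (@sub_finite_set _ _ (F `|` (fiber a y `&` ~` F))).
    by move=> x ax; have [Fx|Fx] := pselect (F x); [left|right].
  rewrite finite_setU; split=> //.
  have [->//|/set0P[x [ax Fx]]] := eqVneq (fiber a y `&` ~` F) set0.
  apply: sub_finite_set (finite_set1 x) => x' [ax' Fx'] /=.
  by apply: injF; rewrite ?inE// ax' -ax.
rewrite /collapse (esumID (a @` F)); last exact: collapse_term_ge0.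
rewrite [X in (_ + X)%E]esum1 ?adde0; last first.
  move=> y [ay Fy]; apply: collapse_term_inj => // x x' axy ax'y.
  apply: injF; rewrite ?inE ?axy//.
  - by move=> Fx; apply: Fy; exists x.
  - by move=> Fx'; apply: Fy; exists x'.
rewrite esum_fset; first last.
- by move=> y /set_mem[/collapse_term_ge0].
- by apply: finite_setIr; exact: finite_image.
rewrite fsbig_finite/=; last by apply: finite_setIr; exact: finite_image.
apply: lte_sum_pinfty => y _.
by rewrite /counting asboolT ?ltry//; exact: finf.
Qed.
End collapse.

(** The source of all the factorizations below: [a] is written as [h \o i], while [b] freely
    prescribes [h] off the range of [i] so that [h] lands in the desired class. *)
Lemma extend_along (X Y Z : Type) (i : X -> Y) (a : X -> Z) (b : Y -> Z) :
  injective i -> exists h : Y -> Z,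
    h \o i = a /\ forall y, ~ range i y -> h y = b y.
Proof.
move=> inji.
have /choice[h hP] y : exists z,
    (forall x, i x = y -> z = a x) /\ (~ range i y -> z = b y).
  have [[x _ <-]|iy] := pselect (range i y).
    by exists (a x); split=> [x' /inji ->//|[]]; exists x.
  by exists (b y); split=> // x ix; case: iy; exists x.
exists h; split=> [|y /(hP y).2//].
by apply/funext => x /=; apply: (hP _).1.
Qed.

Lemma card_eq_set_bij (T U : Type) (A : set T) (B : set U) :
  B !=set0 -> A #= B -> exists f : T -> U, set_bij A B f.
Proof.
elim/Ppointed: U => U in B *; first by case=> u; case: (no u).
by move=> _ /pcard_eqP/bijPex.
Qed.

(** * Injections and surjections of a countably infinite set *)

Section countably_infinite.
Context (R : realType) (X : choiceType) (hX : [set: X] #= [set: nat]).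
Implicit Types (a f g : X -> X) (A : set X) (S : set (X -> X)).

Let infX : infinite_set [set: X].
Proof. by rewrite (eq_finite_set hX); exact: infinite_nat. Qed.

Let x0 : X := projT1 (cid (infinite_setN0 infX)).

Lemma infinite_range_inj f : injective f -> infinite_set (range f).
Proof.
move=> injf.
have fX : range f #= [set: X] by apply: inj_card_eq => x y _ _ /injf.
by rewrite (eq_finite_set fX).
Qed.

Lemma injection_onto A : infinite_set A ->
  exists2 k : X -> X, injective k & range k = A.
Proof.
move=> infA.
have : [set: X] #= A.
  apply: (card_eq_trans hX); rewrite card_eq_sym; apply: eq_card_nat => //.
  apply: (@sub_countable _ _ _ [set: X]); first exact: subset_card_le.
  by rewrite /countable; move: hX; rewrite card_eq_le => /andP[].
move=> /card_eq_set_bij[|k [kA injk Ak]]; first exact: infinite_setN0.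
exists k; first by move=> x y /injk; apply; rewrite inE.
apply/seteqP; split=> [_ [x _ <-]|x /Ak//].
exact: kA.
Qed.

(** A left inverse of an injection with range [A] serves as [g]. *)
Lemma surjection_from A : infinite_set A ->
  exists g, forall y, exists2 x, A x & g x = y.
Proof.
move=> /injection_onto[k injk kA].
have [g [gk _]] := extend_along _ _ _ k id id injk.
exists g => y; exists (k y); first by rewrite -kA; exists y.
by rewrite -[RHS]/(id y) -gk.
Qed.

Lemma injection_infinite_defect :
  exists2 k : X -> X, injective k & infinite_set (~` range k).
Proof.
have [|e [_ inje _]] := card_eq_set_bij _ _ _ _ _ hX; first by exists 0%N.
have [|u [_ inju _]] := card_eq_set_bij _ _ _ _ _ (card_esym hX).
  exact: infinite_setN0.
have {}inje : injective e by move=> x y /inje; apply; rewrite inE.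
have {}inju : injective u by move=> x y /inju; apply; rewrite inE.
(* In the numbering of [X] by [u], the range consists of points with even index, so it misses every
   point with odd index. *)
exists (fun x => u (e x).*2).
  by move=> x y /inju/double_inj/inje.
have odd_inj : injective (fun x => u (e x).*2.+1).
  by move=> x y /inju[]/double_inj/inje.
apply: (sub_infinite_set _ (infinite_range_inj _ odd_inj)).
move=> _ [x _ <-] [y _] /inju.
by move=> /(congr1 odd); rewrite /= !odd_double.
Qed.

(** * The three classes described without cardinal arithmetic *)

Lemma injective_rank f : injective f -> rank R f = +oo%E.
Proof. by move=> /infinite_range_inj inff; apply/counting_eqy. Qed.

Lemma InjXE f : InjX R X f <-> injective f /\ range f <> setT.
Proof.
split=> [[_ /collapse_eq0 injf df]|[injf rf]].
  split=> // rf; apply: df; apply/counting_eq0.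
  by rewrite rf setCT.
split; [exact: injective_rank|exact/collapse_eq0|].
by move=> /counting_eq0/(congr1 setC); rewrite setCK setC0.
Qed.

Lemma SurXI f : range f = setT -> ~ injective f -> SurX R X f.
Proof.
move=> rf injf; split.
- by apply/counting_eqy; rewrite rf.
- by move=> /collapse_eq0.
- by apply/counting_eq0; rewrite rf setCT.
Qed.

Lemma FIXE f : FIX R X f <-> infinite_set (~` range f) /\
  exists2 F, finite_set F & set_inj (~` F) f.
Proof.
split=> [[_ /counting_eqy df /collapse_lty cf]|[df cf]]; first by split.
split; [|exact/counting_eqy|exact/collapse_lty].
(* The rank is infinite because [f] is injective on the infinite complement of [F]. *)
case: cf => F finF injF; apply/counting_eqy => finf.
have : infinite_set (~` F) by rewrite -setTD; exact: infinite_setD.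
rewrite -(eq_finite_set (inj_card_eq injF)); apply.
by apply: sub_finite_set finf => _ [x _ <-]; exists x.
Qed.

Lemma injective_FIX f : injective f -> infinite_set (~` range f) -> FIX R X f.
Proof.
move=> injf df; apply/FIXE; split=> //; exists set0; first exact: finite_set0.
by move=> x y _ _ /injf.
Qed.

Lemma infinite_fiber_notin_FIX f A c : infinite_set A ->
  (forall x, A x -> f x = c) -> ~ FIX R X f.
Proof.
move=> infA fA /FIXE[_ [F finF injF]]; have := infinite_setD infA finF.
apply; have [->//|/set0P[x [Ax Fx]]] := eqVneq (A `\` F) set0.
apply: sub_finite_set (finite_set1 x) => x' [Ax' Fx'] /=.
by apply: injF; rewrite ?inE// !fA.
Qed.

(** * Sets of maps that generate T(X) *)

Section generation.
Context (S : set (X -> X)) (mulS : forall a b, S a -> S b -> S (b \o a)).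

(** Write [a] as [h \o f] with [h] equal to [a x0] off the range of [f]. Since [h] also takes this
    value at [f x0], it is not injective and so lies in [S]. *)
Lemma generated_by_InjX f : ~` InjX R X `<=` S -> InjX R X f -> S f -> S = setT.
Proof.
move=> injS /InjXE[injf rf] Sf; apply/seteqP; split=> // a _.
have [y fy] : exists y, ~ range f y.
  by apply/existsNP => rf'; apply: rf; apply/seteqP; split=> // y _; exact: rf'.
have [h [ha hy]] := extend_along _ _ _ f a (fun=> a x0) injf.
rewrite -ha; apply: mulS => //; apply: injS => /InjXE[injh _].
by apply: (fy); exists x0 => //; apply: injh; rewrite (hy y)// -ha.
Qed.

(** Choose [k] injective with range the complement of [F], so that [f \o k] is injective, and write
    [a] as [h \o (f \o k)]. The map [k] avoids FI because its defect is finite, and [h] because it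
    is constant on the infinite complement of the range of [f]. *)
Lemma generated_by_FIX f : ~` FIX R X `<=` S -> FIX R X f -> S f -> S = setT.
Proof.
move=> fiS /FIXE[df [F finF injF]] Sf; apply/seteqP; split=> // a _.
have [|k injk kF] := injection_onto (~` F).
  by rewrite -setTD; exact: infinite_setD.
have kNF x : ~ F (k x) by rewrite -[~ _]/((~` F) (k x)) -kF; exists x.
have injfk : injective (f \o k).
  by move=> x y /= /injF; rewrite !inE => /(_ (kNF x) (kNF y))/injk.
have [h [<- hy]] := extend_along _ _ _ (f \o k) a (fun=> x0) injfk.
have dfk y : (~` range f) y -> ~ range (f \o k) y.
  by apply: contra_not => -[x _ <-]; exists (k x).
apply: mulS; [apply: mulS => //|]; apply: fiS.
  by move=> /FIXE[+ _]; rewrite kF setCK.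
by apply: (infinite_fiber_notin_FIX _ _ x0 df) => y /dfk/hy.
Qed.

Context (SurS : SurX R X `<=` S).

(** In [a = h \o f], let [h] map the complement of the range of [f] onto X. Then [h] is surjective,
    and it is not injective because the value [a x0] is taken both at [f x0] and off the range. *)
Lemma generated_by_infinite_defect f :
  injective f -> infinite_set (~` range f) -> S f -> S = setT.
Proof.
move=> injf df Sf; apply/seteqP; split=> // a _.
have [g gP] := surjection_from _ df.
have [h [ha hg]] := extend_along _ _ _ f a g injf.
rewrite -ha; apply: mulS => //; apply: SurS; apply: SurXI.
  apply/seteqP; split=> // y _; have [x fx <-] := gP y.
  by exists x => //; exact: hg.
move=> injh; have [x fx gx] := gP (a x0); apply: (fx); exists x0 => //.
by apply: injh; rewrite (hg x)// gx -ha.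
Qed.

(** In [a = h \o f], the map [h] inherits surjectivity from [a], and a point missed by [f] is sent
    to [a x0], which spoils injectivity. This is what puts transpositions into [S]. *)
Lemma bijective_mem f a : InjX R X f -> S f -> range a = setT -> S a.
Proof.
move=> /InjXE[injf rf] Sf ra.
have [y fy] : exists y, ~ range f y.
  by apply/existsNP => rf'; apply: rf; apply/seteqP; split=> // y _; exact: rf'.
have [h [ha hy]] := extend_along _ _ _ f a (fun=> a x0) injf.
rewrite -ha; apply: mulS => //; apply: SurS; apply: SurXI.
  apply/seteqP; split=> // z _; have : range a z by rewrite ra.
  by case=> x _ <-; exists (f x) => //; rewrite -ha.
move=> injh; apply: (fy); exists x0 => //; apply: injh.
by rewrite (hy y)// -ha.
Qed.

(** Induction on a list of the points of [F]: each step removes one more point from the range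
    without adding any. *)
Lemma injection_avoiding f (F : set X) : InjX R X f -> S f -> finite_set F ->
  exists k, [/\ S k, injective k & range k `<=` ~` F].
Proof.
move=> If Sf /finite_seqP[s ->]; have [injf rf] := (InjXE _).1 If.
have [z fz] : exists z, ~ range f z.
  by apply/existsNP => rf'; apply: rf; apply/seteqP; split=> // y _; exact: rf'.
elim: s => [|x s [k [Sk injk ks]]]; first by exists f; split.
have [[y _ kx]|kx] := pselect (range k x); last first.
  exists k; split=> // _ [w _ <-] /=; rewrite inE => /orP[/eqP kwx|kws].
    by apply: kx; exists w.
  by apply: (ks (k w)) => //; exists w.
(* The transposition of [y] and [z]. As [f] misses [z], the map [t \o f] misses [y], the only
   preimage of [x] under [k]; hence [k \o t \o f] misses [x]. *)
pose t u := if u == y then z else if u == z then y else u.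
have tt : involutive t.
  move=> u; rewrite /t; have [->|uy] := eqVneq u y.
    by rewrite eqxx; case: eqVneq.
  by have [->|uz] := eqVneq u z; rewrite ?eqxx// (negbTE uy) (negbTE uz).
have St : S t.
  by apply: (bijective_mem f) => //; apply/seteqP; split=> // u _; exists (t u).
exists (k \o t \o f); split; first by do 2 apply: mulS => //.
  by move=> u v /= /injk/(inv_inj tt)/injf.
move=> _ [w _ <-] /=; rewrite inE => /orP[/eqP|kws].
  rewrite -kx => /injk tfw; apply: fz; exists w => //.
  by rewrite -[LHS]tt tfw /t eqxx.
by apply: (ks (k (t (f w)))) => //; exists (t (f w)).
Qed.

Lemma generated_by_InjX_FIX f g :
  InjX R X f -> S f -> FIX R X g -> S g -> S = setT.
Proof.
move=> If Sf /FIXE[dg [F finF injF]] Sg.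
have [k [Sk injk kF]] := injection_avoiding f F If Sf finF.
have kNF x : ~ F (k x) by apply: kF; exists x.
apply: (generated_by_infinite_defect (g \o k)); last exact: mulS.
  by move=> x y /= /injF; rewrite !inE => /(_ (kNF x) (kNF y))/injk.
apply: (sub_infinite_set _ dg) => y gy [x _ gkx]; apply: gy; exists (k x) => //.
Qed.

End generation.

(** * The two complements as proper subsemigroups, and their maximality *)

Lemma InjX_nonempty : InjX R X !=set0.
Proof.
have [k injk dk] := injection_infinite_defect.
exists k; apply/InjXE; split=> //.
by move=> rk; apply: dk; rewrite rk setCT.
Qed.

Lemma FIX_nonempty : FIX R X !=set0.
Proof.
have [k injk dk] := injection_infinite_defect.
by exists k; exact: injective_FIX.
Qed.

(** If [b \o a] is in Inj, then [a] is injective, hence bijective when it is not in Inj itself. Then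
    [b] is injective with the same range as [b \o a], so [b] is in Inj. *)
Lemma subsemigroup_not_InjX : subsemigroup (setT `\` InjX R X).
Proof.
split.
  by exists id; split=> // /InjXE[_]; apply; rewrite image_id.
move=> a b [_ Ia] [_ Ib]; split=> // /InjXE[injba rba].
have inja : injective a by move=> x y /(congr1 b)/injba.
have ra : range a = setT by apply: contrapT => ra; apply: Ia; apply/InjXE.
have surja y : exists x, a x = y.
  by have [x _ <-] : range a y; [rewrite ra|exists x].
apply: Ib; apply/InjXE; split.
  by move=> y y'; have [x <-] := surja y; have [x' <-] := surja y' => /injba ->.
by move=> rb; apply: rba; rewrite -(image_comp a b) ra.
Qed.

(** If [b \o a] is in FI and [a] is not, then [a] is injective off [F], so its defect is finite. A
    point missed by [b \o a] is missed by [b] or is the image under [b] of one of the finitely many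
    points missed by [a]; hence [b] has infinite defect. *)
Lemma subsemigroup_not_FIX : subsemigroup (setT `\` FIX R X).
Proof.
split.
  exists id; split=> // /FIXE[+ _]; apply; rewrite image_id setCT.
  exact: finite_set0.
move=> a b [_ Ia] [_ Ib]; split=> // /FIXE[dba [F finF injF]].
have da : finite_set (~` range a).
  apply: contrapT => da; apply: Ia; apply/FIXE; split=> //; exists F => // x y.
  by move=> xF yF axy; apply: injF => //=; rewrite axy.
apply: Ib; apply/FIXE; split.
  move=> db; apply: dba.
  apply: (@sub_finite_set _ _ (~` range b `|` b @` (~` range a))).
    move=> y bay; have [[z _ bz]|by'] := pselect (range b y); last by left.
    right; exists z => // -[x _ ax]; apply: bay; exists x => //=.
    by rewrite ax.
  by rewrite finite_setU; split=> //; exact: finite_image.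
(* Points off this finite set are images under [a] of points off [F], where [b \o a] is
   injective. *)
exists (~` range a `|` a @` F).
  by rewrite finite_setU; split=> //; exact: finite_image.
have lift y : y \in ~` (~` range a `|` a @` F) ->
    exists2 x, x \in ~` F & a x = y.
  rewrite inE => /not_orP[/contrapT[x _ <-] aF]; exists x => //.
  by rewrite inE => Fx; apply: aF; exists x.
by move=> _ _ /lift[x xF <-] /lift[x' x'F <-] /injF ->.
Qed.

(** A subsemigroup strictly above [S] contains an element of [N], which together with [S] generates
    everything. *)
Lemma maximal_complement S N : S = setT `\` N -> N !=set0 -> subsemigroup S ->
  (forall U f, subsemigroup U -> ~` N `<=` U -> N f -> U f -> U = setT) ->
  maximal_subsemigroup S.
Proof.
move=> SN [f Nf] sgS gen; split=> //.
  by move=> ST; have : S f by [rewrite ST]; rewrite SN => -[_]; apply.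
case=> U [sgU [SU US] [_ UT]]; apply: UT.
have [g [Ug Sg]] : exists g, U g /\ ~ S g.
  apply: contrapT => UgS; apply: US => g Ug; apply: contrapT => Sg.
  by apply: UgS; exists g.
have Ng : N g by apply: contrapT => Ng; apply: Sg; rewrite SN.
by rewrite (gen U g)// => h Nh; apply: SU; rewrite SN.
Qed.

Lemma maximal_eq S T : maximal_subsemigroup S -> subsemigroup T ->
  S `<=` T -> T <> setT -> S = T.
Proof.
move=> [_ _ maxS] sgT ST TT; apply/seteqP; split=> // f Tf.
apply: contrapT => Sf; apply: maxS; exists T.
split=> //; split=> //; first by move=> /(_ f Tf).
by move=> T1; apply: TT; apply/seteqP; split.
Qed.

End countably_infinite.

Theorem theorem8 (R : realType) (X : choiceType)
    (hX : [set: X] #= [set: nat])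
    (S : set (X -> X)) (hS : subsemigroup S) (hSur : SurX R X `<=` S) :
  maximal_subsemigroup S <->
  (S = [set: X -> X] `\` InjX R X \/ S = [set: X -> X] `\` FIX R X).
Proof.
split=> [maxS|[SE|SE]].
- have [_ ST _] := maxS.
  have compl (N : set (X -> X)) : N !=set0 -> setT `\` N <> setT.
    move=> [f Nf] NT; have : (setT `\` N) f by rewrite NT.
    by case.
  (* If [S] meets Inj, it must miss FI, since otherwise it would be all of T(X). Either way [S] lies
     in one of the two proper subsemigroups, and maximality gives equality. *)
  have [[f [If Sf]]|noI] := pselect (exists f, InjX R X f /\ S f).
    right; apply: maximal_eq => //.
    + exact: subsemigroup_not_FIX.
    + move=> g Sg; split=> // Fg; apply: ST.
      exact: (generated_by_InjX_FIX R X hX S hS.2 hSur f g).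
    + exact/compl/FIX_nonempty.
  left; apply: maximal_eq => //.
  + exact: subsemigroup_not_InjX.
  + by move=> g Sg; split=> // Ig; apply: noI; exists g.
  + exact/compl/InjX_nonempty.
- apply: maximal_complement SE _ hS _; first exact: InjX_nonempty.
  by move=> U f [_ mulU]; exact: generated_by_InjX.
- apply: maximal_complement SE _ hS _; first exact: FIX_nonempty.
  by move=> U f [_ mulU]; exact: generated_by_FIX.
Qed.
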